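(* Fix integers $q\ge 2$ and $t\ge 1$. There is a constant $A=A_{t,q}$ such that the following holds. Let $\mathcal F$ be a random $k\times n$ array whose entries are chosen independently and uniformly from $\{0,1,\ldots,q-1\}$, where $k=k(n)$ satisfies \[k\le \frac{t\lg n-h(n)}{\lg\left(q^t/(q^t-1)\right)}\] for some function $h(n)\ge A\lg\lg n$. Then the probability that $\mathcal F$ is a $(t,q,n,k,1)$-covering array tends to $0$ as $n\to\infty$.
   Context: $\lg=\log_2$. A $k\times n$ array with entries in $\{0,\ldots,q-1\}$ is a $(t,q,n,k,1)$-covering array if for every choice of $t$ of the $n$ columns, each of the $q^t$ words of length $t$ over $\{0,\ldots,q-1\}$ appears in at least one row restricted to those columns. *)

(* Defs.v *)
From HB Require Import structures.
From mathcomp Require Export all_boot all_order all_algebra.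
From mathcomp Require Export all_classical all_reals all_analysis.
Set Implicit Arguments.
Unset Strict Implicit.
Unset Printing Implicit Defensive.
Import Order.TTheory GRing.Theory Num.Theory.
Import numFieldNormedType.Exports.
Local Open Scope ring_scope.

Definition lg (R : realType) (x : R) : R := ln x / ln 2.

(* A choice of t of the n columns is an injection c : 'I_t -> 'I_n; the order
   in which c lists the columns is immaterial since w runs over all words. *)
Definition covering_array (t q n k : nat) (M : 'M['I_q]_(k, n)) : bool :=
  [forall c : {ffun 'I_t -> 'I_n}, injectiveb c ==>
    [forall w : t.-tuple 'I_q,
      [exists i : 'I_k, [tuple M i (c s) | s < t] == w]]].

Definition uniform_mass (R : realType) (q : nat) (a : 'I_q) : R := q%:R^-1.

(* Independence of the entries: the law of the array is the product of the
   laws of its entries. *)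
Definition array_mass (R : realType) (q n k : nat) (M : 'M['I_q]_(k, n)) : R :=
  \prod_(i < k) \prod_(j < n) uniform_mass R (M i j).

Definition array_prob (R : realType) (q n k : nat)
    (E : pred 'M['I_q]_(k, n)) : R :=
  \sum_(M : 'M['I_q]_(k, n) | E M) array_mass R M.

(* Main.v *)
(* Second moment method. Cut the columns into t disjoint blocks of m = n / t
   columns and let X count the choices c of one column per block such that no
   row vanishes on all the chosen columns; a covering array has X = 0. With
   N = q^t and p = (1 - 1/N)^k, each c has probability p, while two choices
   agreeing in exactly j blocks have joint probability p^2 r_j^k, where
   r_j = 1 + (q^j - 1) / (N - 1)^2. The sequence r_j is log-convex with r_0 = 1
   and r_t = N / (N - 1), so r_j <= a^j where a^t = N / (N - 1). Summing over
   all pairs gives E X^2 / (E X)^2 <= (1 + a^k / m)^t, and the hypothesis on k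
   makes a^k / m of order at most 1 / lg n, so Chebyshev's inequality
   concludes. *)

Require Import Defs.
From mathcomp Require Import all_boot all_order all_algebra.
From mathcomp Require Import all_classical all_reals all_analysis.
From mathcomp Require Import ring lra.
Set Implicit Arguments.
Unset Strict Implicit.
Unset Printing Implicit Defensive.
Import Order.TTheory GRing.Theory Num.Theory.
Import numFieldNormedType.Exports.
Local Open Scope classical_set_scope.
Local Open Scope ring_scope.

(** * Moment inequalities for a two-point distribution *)

Section PowerMean.
Variable (R : realFieldType).

(** Lyapunov's inequality for the moments [r i] of a variable equal to 1 with weight [a] and to [x]
    with weight [b]: [r] is log-convex and [r 0 = 1]. *)
Lemma two_point_moment_step (a b x : R) (j : nat) :
  0 <= a -> 0 <= b -> 0 <= x -> a + b = 1 ->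
  (forall i, 0 < a + b * x ^+ i) ->
  (a + b * x ^+ j) ^+ j.+1 <= (a + b * x ^+ j.+1) ^+ j.
Proof.
move=> a0 b0 x0 ab1 rpos.
pose r i := a + b * x ^+ i; rewrite -!/(r _).
have rP i : 0 < r i by exact: rpos.
have logconvex i : r i.+1 ^+ 2 <= r i * r i.+2.
  rewrite -subr_ge0.
  have -> : r i * r i.+2 - r i.+1 ^+ 2 = a * b * x ^+ i * (x - 1) ^+ 2.
    by rewrite /r !exprS; ring.
  by apply: mulr_ge0 (sqr_ge0 _); rewrite !mulr_ge0 ?exprn_ge0.
elim: j => [|j IH]; first by rewrite expr1 expr0 /r expr0 mulr1 ab1.
(* Log-convexity raised to the power [j.+1]. The induction hypothesis replaces [r j ^+ j.+1] by
   [r j.+1 ^+ j], which then cancels on both sides. *)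
have le1 : r j.+1 ^+ (2 * j.+1) <= r j ^+ j.+1 * r j.+2 ^+ j.+1.
  rewrite exprM -exprMn; apply: lerXn2r (logconvex j).
    by rewrite nnegrE sqr_ge0.
  by rewrite nnegrE mulr_ge0 ?ltW.
have := le_trans le1 (ler_wpM2r (exprn_ge0 _ (ltW (rP j.+2))) IH).
have -> : (2 * j.+1 = j + j.+2)%N by rewrite mulnC muln2 -addnn addSnnS.
by rewrite exprD ler_pM2l// exprn_gt0.
Qed.

(** Descending induction from the equality at [t]: if the bound holds at [l.+1], the previous lemma
    bounds the [l.+1]-st power of the [l]-th moment by [y ^+ (l * l.+1)], and roots are taken. *)
Lemma two_point_moment_le (a b x y : R) (t j : nat) :
  0 <= a -> 0 <= b -> 0 < x -> a + b = 1 -> 0 <= y ->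
  a + b * x ^+ t = y ^+ t -> (j <= t)%N -> a + b * x ^+ j <= y ^+ j.
Proof.
move=> a0 b0 x0 ab1 y0 ht.
have rP i : 0 < a + b * x ^+ i.
  have [b_eq0|bn0] := eqVneq b 0; first by rewrite b_eq0 mul0r; lra.
  by rewrite ltr_wpDl// mulr_gt0 ?exprn_gt0// lt_def bn0.
move=> /subnK; move: (t - j)%N => i; elim: i j => [|i IH] l.
  by rewrite add0n => ->; rewrite ht.
rewrite addSnnS => /IH {}IH.
rewrite -(@ler_pXn2r _ l.+1) ?nnegrE ?exprn_ge0 ?(ltW (rP _))//.
apply: le_trans (two_point_moment_step l a0 b0 (ltW x0) ab1 rP) _.
rewrite -exprM mulnC exprM.
by apply: lerXn2r; rewrite ?nnegrE ?exprn_ge0 ?(ltW (rP _)).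
Qed.

End PowerMean.

(** * Expectations over the random array *)

Section RandomArray.
Variables (R : realType) (q n k : nat).
Hypothesis q0 : (0 < q)%N.

Definition row_mass (f : {ffun 'I_n -> 'I_q}) : R :=
  \prod_(j < n) uniform_mass R (f j).

Definition array_expect (F : 'M['I_q]_(k, n) -> R) : R :=
  \sum_(M : 'M['I_q]_(k, n)) array_mass R M * F M.

Definition row_ffun (M : 'M['I_q]_(k, n)) (i : 'I_k) : {ffun 'I_n -> 'I_q} :=
  [ffun j => M i j].

(** Independence of the rows: an array is a [k]-tuple of rows, and distributivity turns the sum over
    tuples into a power. *)
Lemma array_expect_prod (G : {ffun 'I_n -> 'I_q} -> R) :
  array_expect (fun M => \prod_(i < k) G (row_ffun M i)) =
  (\sum_f row_mass f * G f) ^+ k.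
Proof.
rewrite -[in RHS](card_ord k) -prodr_const bigA_distr_bigA /=.
rewrite (reindex (fun M => [ffun i => row_ffun M i])) /=; last first.
  exists (fun g : {ffun 'I_k -> {ffun 'I_n -> 'I_q}} => \matrix_(i, j) g i j).
    by move=> M _; apply/matrixP => i j; rewrite !mxE !ffunE.
  by move=> g _; apply/ffunP => i; apply/ffunP => j; rewrite !ffunE mxE.
apply: eq_bigr => M _; rewrite /array_mass -big_split /=.
by apply: eq_bigr => i _; rewrite ffunE.
Qed.

Variable a0 : 'I_q.

(** A 0/1 indicator, written as a product over columns so that sums over rows factor column by
    column. *)
Definition const_on (S : {set 'I_n}) (f : {ffun 'I_n -> 'I_q}) : R :=
  \prod_(j in S) (f j == a0)%:R.

Lemma row_mass_const_on (S : {set 'I_n}) :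
  \sum_f row_mass f * const_on S f = q%:R^-1 ^+ #|S|.
Proof.
have qn0 : (q%:R : R) != 0 by rewrite pnatr_eq0 -lt0n.
transitivity (\prod_(j < n) \sum_(a : 'I_q)
   (q%:R^-1 * (if j \in S then (a == a0)%:R else 1)) : R).
  rewrite bigA_distr_bigA; apply: eq_bigr => f _.
  by rewrite /row_mass /const_on [X in _ * X]big_mkcond -big_split.
rewrite -prodr_const [RHS]big_mkcond; apply: eq_bigr => j _.
rewrite -big_distrr /=; case: ifP => _; last first.
  by rewrite sumr_const card_ord mulVf.
by rewrite (bigD1 a0)//= eqxx big1 ?addr0 ?mulr1// => a /negPf ->.
Qed.

Lemma row_mass_sum : \sum_f row_mass f = 1.
Proof.
have := row_mass_const_on finset.set0; rewrite cards0 expr0 => <-.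
by apply: eq_bigr => f _; rewrite /const_on big_set0 mulr1.
Qed.

Lemma const_onM (S T : {set 'I_n}) f :
  const_on S f * const_on T f = const_on (S :|: T) f.
Proof.
rewrite /const_on !(big_mkcond (fun j => j \in _)) -big_split /=.
apply: eq_bigr => j _; rewrite inE.
by do 2 case: (j \in _); rewrite ?mulr1 ?mul1r//= -natrM mulnb andbb.
Qed.

(* The indicator that no row of [M] is constantly [a0] on the columns [S]. *)
Definition avoids (S : {set 'I_n}) (M : 'M['I_q]_(k, n)) : R :=
  \prod_(i < k) (1 - const_on S (row_ffun M i)).

Lemma expect_avoids (S : {set 'I_n}) :
  array_expect (avoids S) = (1 - q%:R^-1 ^+ #|S|) ^+ k.
Proof.
rewrite /avoids (array_expect_prod (fun f => 1 - const_on S f)).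
under eq_bigr do rewrite mulrBr mulr1.
by rewrite big_split sumrN /= row_mass_sum row_mass_const_on.
Qed.

(** Inclusion-exclusion within one row: the product of the indicators of [S] and [T] is that of
    [S :|: T]. *)
Lemma expect_avoidsM (S T : {set 'I_n}) :
  array_expect (fun M => avoids S M * avoids T M) =
  (1 - q%:R^-1 ^+ #|S| - q%:R^-1 ^+ #|T| + q%:R^-1 ^+ #|S :|: T|) ^+ k.
Proof.
rewrite (_ : array_expect _ = array_expect (fun M => \prod_(i < k)
    ((1 - const_on S (row_ffun M i)) * (1 - const_on T (row_ffun M i)))));
  last by apply: eq_bigr => M _; rewrite big_split.
rewrite (array_expect_prod (fun f => (1 - const_on S f) * (1 - const_on T f))).
rewrite -!row_mass_const_on -[X in _ = (X - _ - _ + _) ^+ _]row_mass_sum.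
rewrite -!sumrB -big_split /=; congr (_ ^+ _).
by apply: eq_bigr => f _; rewrite -const_onM; ring.
Qed.

Lemma expect_sum (I : finType) (F : I -> 'M['I_q]_(k, n) -> R) :
  array_expect (fun M => \sum_i F i M) = \sum_i array_expect (F i).
Proof.
rewrite /array_expect exchange_big /=; apply: eq_bigr => M _.
by rewrite big_distrr.
Qed.

Lemma array_mass_ge0 (M : 'M['I_q]_(k, n)) : 0 <= array_mass R M.
Proof.
by apply: prodr_ge0 => i _; apply: prodr_ge0 => j _; rewrite invr_ge0 ler0n.
Qed.

Lemma array_mass_sum : array_expect (fun=> 1) = 1.
Proof.
transitivity
  (array_expect (fun M : 'M['I_q]_(k, n) => \prod_(i < k) (1 : R))).
  by apply: eq_bigr => M _; rewrite big1_eq.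
rewrite (array_expect_prod (fun=> 1)) -[RHS](expr1n _ k); congr (_ ^+ _).
by rewrite -[RHS]row_mass_sum; apply: eq_bigr => f _; rewrite mulr1.
Qed.

(** Chebyshev's inequality: on [E] the squared deviation of [X] from its mean equals the square of
    the mean, so the variance is at least that square times the probability of [E]. *)
Lemma second_moment_bound (E : pred 'M['I_q]_(k, n))
    (X : 'M['I_q]_(k, n) -> R) :
  (forall M, E M -> X M = 0) -> 0 < array_expect X ->
  array_prob R E <=
    array_expect (fun M => X M * X M) / array_expect X ^+ 2 - 1.
Proof.
move=> EX0 e0; set e := array_expect X.
have en0 : e != 0 by rewrite gt_eqF.
have -> : array_expect (fun M => X M * X M) / e ^+ 2 - 1 =
    (array_expect (fun M => (X M - e) ^+ 2)) / e ^+ 2.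
  have -> u : array_expect (fun M => (X M - u) ^+ 2) =
      array_expect (fun M => X M * X M) - 2 * u * array_expect X
      + u ^+ 2 * array_expect (fun=> 1).
    rewrite /array_expect !big_distrr /= -sumrB -big_split /=.
    by apply: eq_bigr => M _; ring.
  by rewrite array_mass_sum -/e; field.
rewrite ler_pdivlMr ?exprn_gt0// /array_prob mulr_suml big_mkcond /=.
apply: ler_sum => M _; case: ifPn => EM.
  by rewrite EX0// sub0r sqrrN.
by rewrite mulr_ge0 ?sqr_ge0 ?array_mass_ge0.
Qed.

End RandomArray.

(** * Covering arrays and block transversals *)

Lemma covering_avoids0 (R : realType) (t q n k : nat) (a0 : 'I_q)
    (c : 'I_t -> 'I_n) (M : 'M['I_q]_(k, n)) :
  injective c -> covering_array t M ->
  avoids R a0 [set c s | s : 'I_t] M = 0.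
Proof.
move=> cI /forallP /(_ [ffun s => c s]) /implyP /(_ _).
have -> : injectiveb [ffun s => c s].
  by apply/injectiveP => s1 s2; rewrite !ffunE; exact: cI.
(* The row [i] that carries the constant word [a0] contributes a zero factor to [avoids]. *)
move=> /(_ isT) /forallP /(_ [tuple a0 | s < t]) /existsP[i /eqP Mi].
rewrite /avoids (bigD1 i)//= /const_on big1 ?subrr ?mul0r// => j.
case/imsetP => s _ ->; rewrite ffunE.
have /(congr1 (fun w => tnth w s)) := Mi.
by rewrite !tnth_mktuple ffunE => ->; rewrite eqxx.
Qed.

(* The columns [col (s, x)], [x < m], form the [s]-th of [t] disjoint blocks. *)
Section BlockTransversals.
Variables (R : realType) (q n k t m : nat).
Hypotheses (q2 : (2 <= q)%N) (t0 : (0 < t)%N) (m0 : (0 < m)%N).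
Variable col : 'I_t * 'I_m -> 'I_n.
Hypothesis col_inj : injective col.

Definition transversal_set (c : {ffun 'I_t -> 'I_m}) : {set 'I_n} :=
  [set col (s, c s) | s : 'I_t].

Definition agreements (c d : {ffun 'I_t -> 'I_m}) : {set 'I_t} :=
  [set s | c s == d s]%SET.

Lemma transversal_inj (c : {ffun 'I_t -> 'I_m}) :
  injective (fun s => col (s, c s)).
Proof. by move=> s1 s2 /col_inj []. Qed.

Lemma card_transversal c : #|transversal_set c| = t.
Proof. by rewrite card_imset ?card_ord//; exact: transversal_inj. Qed.

(** A column determines its block and its position there, so the transversals meet exactly in the
    columns of the blocks where [c] and [d] agree. *)
Lemma card_transversalU (c d : {ffun 'I_t -> 'I_m}) :
  (#|transversal_set c :|: transversal_set d| + #|agreements c d| =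
   t + t)%N.
Proof.
have -> : #|agreements c d| = #|transversal_set c :&: transversal_set d|.
  rewrite -(card_imset _ (@transversal_inj c)); congr #|pred_of_set _|.
  apply/setP => x; rewrite inE; apply/imsetP/andP => [[s]|].
    rewrite inE => /eqP cd ->; split; apply/imsetP; exists s => //.
    by rewrite cd.
  case=> /imsetP[s _ ->] /imsetP[s' _ /col_inj[ss' cs]].
  by exists s => //; rewrite inE cs ss'.
by rewrite cardsUI !card_transversal.
Qed.

Let N : R := q%:R ^+ t.

Lemma alphabet_power_ge2 : 2 <= N.
Proof.
rewrite /N -natrX ler_nat (leq_trans q2)// -[leqLHS]expn1.
by rewrite leq_pexp2l// (leq_trans _ q2).
Qed.

Variable a : R.
Hypotheses (a0 : 0 <= a) (aN : a ^+ t = N / (N - 1)).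

(** With [j] agreements the union has [2t - j] columns, and the left side is [(1 - N^-1) ^+ 2] times
    the [j]-th moment of a two-point distribution on 1 and [q], whose [t]-th moment is
    [N / (N - 1) = a ^+ t]. *)
Lemma pair_avoid_ratio (c d : {ffun 'I_t -> 'I_m}) :
  1 - q%:R^-1 ^+ #|transversal_set c| - q%:R^-1 ^+ #|transversal_set d|
    + q%:R^-1 ^+ #|transversal_set c :|: transversal_set d|
  <= (1 - N^-1) ^+ 2 * a ^+ #|agreements c d|.
Proof.
have N2 := alphabet_power_ge2.
have q0 : 0 < (q%:R : R) by rewrite ltr0n (leq_trans _ q2).
have N0 : N != 0 by lra.
have N1 : N - 1 != 0 by lra.
have := card_transversalU c d; rewrite !card_transversal.
set j := #|_ : {set 'I_t}| => Uj.
have jt : (j <= t)%N by rewrite -[leqRHS]card_ord max_card.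
pose b := (N - 1) ^- 2.
have -> : (q%:R^-1 : R) ^+ #|transversal_set c :|: transversal_set d| =
    q%:R ^+ j / N ^+ 2.
  have qn0 : (q%:R : R) != 0 by rewrite gt_eqF.
  rewrite /N -exprM muln2 -addnn -Uj exprD invfM mulrCA.
  by rewrite divff ?mulr1 ?exprVn// expf_neq0.
rewrite exprVn -/N.
have -> : 1 - N^-1 - N^-1 + q%:R ^+ j / N ^+ 2 =
    (1 - N^-1) ^+ 2 * ((1 - b) + b * q%:R ^+ j).
  by rewrite /b; field; rewrite N0 N1.
apply: ler_wpM2l; first exact: sqr_ge0.
have b0 : 0 <= b by rewrite invr_ge0 sqr_ge0.
have b1 : b <= 1.
  by rewrite invf_le1 ?exprn_gt0 ?exprn_ege1//; lra.
apply: (@two_point_moment_le _ _ _ _ _ t) => //; try lra.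
by rewrite aN -/N /b; field; rewrite N1.
Qed.

(** The sum factors over blocks: in each, one position agrees with [c] and has weight [rho], and the
    other [m - 1] have weight 1. *)
Lemma sum_agreements (rho : R) (c : {ffun 'I_t -> 'I_m}) :
  \sum_(d : {ffun 'I_t -> 'I_m}) rho ^+ #|agreements c d| =
  (m%:R - 1 + rho) ^+ t.
Proof.
transitivity (\prod_(s < t) \sum_(x < m) (if c s == x then rho else 1)).
  rewrite bigA_distr_bigA; apply: eq_bigr => d _.
  rewrite -prodr_const big_mkcond; apply: eq_bigr => s _.
  by rewrite inE.
rewrite -[in RHS](card_ord t) -prodr_const; apply: eq_bigr => s _.
rewrite (bigD1 (c s))//= eqxx addrC; congr (_ + _).
rewrite (eq_bigr (fun=> 1)) => [|x /negPf]; last by rewrite eq_sym => ->.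
rewrite sumr_const cardC1 card_ord.
by rewrite -[in RHS](prednK m0) -natr1 addrK.
Qed.

Lemma covering_prob_le :
  array_prob R (@covering_array t q n k) <= (1 + a ^+ k / m%:R) ^+ t - 1.
Proof.
have N2 := alphabet_power_ge2.
have q0 : (0 < q)%N by rewrite (leq_trans _ q2).
have mR0 : 0 < (m%:R : R) by rewrite ltr0n.
pose z : 'I_q := Ordinal q0.
pose X (M : 'M['I_q]_(k, n)) :=
  \sum_(c : {ffun 'I_t -> 'I_m}) avoids R z (transversal_set c) M.
pose p : R := (1 - N^-1) ^+ k.
have p0 : 0 < p.
  by rewrite exprn_gt0// subr_gt0 invf_lt1; lra.
have EX : array_expect X = m%:R ^+ t * p.
  rewrite /X expect_sum (eq_bigr (fun=> p)) => [|c _]; last first.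
    by rewrite expect_avoids// card_transversal exprVn.
  by rewrite sumr_const card_ffun !card_ord -natrX mulr_natl.
have EX2 : array_expect (fun M => X M * X M) <=
    m%:R ^+ t * (m%:R - 1 + a ^+ k) ^+ t * p ^+ 2.
  have -> : array_expect (fun M => X M * X M) =
     \sum_c \sum_d array_expect (fun M : 'M['I_q]_(k, n) =>
       avoids R z (transversal_set c) M * avoids R z (transversal_set d) M).
    under [RHS]eq_bigr do rewrite -expect_sum.
    rewrite -expect_sum; apply: eq_bigr => M _; congr (_ * _).
    by rewrite /X big_distrl; apply: eq_bigr => c _; rewrite big_distrr.
  apply: (@le_trans _ _ (\sum_(c : {ffun 'I_t -> 'I_m})
      \sum_(d : {ffun 'I_t -> 'I_m})
        p ^+ 2 * (a ^+ k) ^+ #|agreements c d|)).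
    apply: ler_sum => c _; apply: ler_sum => d _.
    rewrite expect_avoidsM// /p (exprAC (1 - N^-1) k) (exprAC a k) -exprMn.
    apply: lerXn2r (pair_avoid_ratio c d); rewrite nnegrE.
      rewrite !card_transversal exprVn -/N addr_ge0 ?exprn_ge0//.
      (* Monotonicity of the [k]-th power needs a nonnegative base, and [1 - 2 / N >= 0] because
         [N >= 2]. *)
      have : N^-1 <= 2^-1 by rewrite lef_pV2 ?posrE//; lra.
      by lra.
    by apply: mulr_ge0; rewrite ?sqr_ge0 ?exprn_ge0.
  rewrite (eq_bigr (fun=> p ^+ 2 * (m%:R - 1 + a ^+ k) ^+ t)); last first.
    by move=> c _; rewrite -(sum_agreements _ c) big_distrr.
  rewrite sumr_const card_ffun !card_ord -[leLHS]mulr_natl natrX.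
  by rewrite -mulrA (mulrC (p ^+ 2)).
have E0 : 0 < array_expect X.
  by rewrite EX; exact: mulr_gt0 (exprn_gt0 _ mR0) p0.
have cov0 (M : 'M['I_q]_(k, n)) : covering_array t M -> X M = 0.
  move=> cov; rewrite /X big1// => c _.
  by apply: covering_avoids0 cov; exact: transversal_inj.
apply: le_trans (second_moment_bound q0 z cov0 E0) _.
rewrite lerD2r ler_pdivrMr ?exprn_gt0// (le_trans EX2)// EX.
have -> : (1 + a ^+ k / m%:R) ^+ t * (m%:R ^+ t * p) ^+ 2 =
    m%:R ^+ t * (m%:R + a ^+ k) ^+ t * p ^+ 2.
  have -> : m%:R + a ^+ k = m%:R * (1 + a ^+ k / m%:R).
    by rewrite mulrDr mulr1 mulrCA divff ?mulr1 ?gt_eqF.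
  by rewrite !exprMn; ring.
apply: ler_wpM2r; first exact: sqr_ge0.
apply: ler_wpM2l; first by rewrite exprn_ge0// ltW.
(* The gain of [- 1] from [sum_agreements] is given up here. *)
apply: lerXn2r; rewrite ?nnegrE; last by rewrite lerD2r gerBl.
  by rewrite addr_ge0 ?exprn_ge0// subr_ge0 ler1n.
by rewrite addr_ge0 ?exprn_ge0// ltW.
Qed.

End BlockTransversals.

(** * Asymptotics in the number of columns *)

Lemma cvg_ln_natV (R : realType) : (ln (n%:R : R))^-1 @[n --> \oo] --> (0 : R).
Proof.
apply/gtr0_cvgV0.
  near=> n; apply: ln_gt0; rewrite ltr1n.
  by near: n; exact: nbhs_infty_gt.
apply/cvgryPge => A; near=> n.
have An : expR A <= n%:R by near: n; exact: nbhs_infty_ger.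
rewrite -[A]expRK ler_ln ?posrE ?expR_gt0//.
exact: lt_le_trans (expR_gt0 A) An.
Unshelve. all: by end_near. Qed.

Lemma block_size_ge (R : realType) (n t : nat) : (0 < t)%N -> (t <= n)%N ->
  (n%:R : R) <= 2 * t%:R * (n %/ t)%:R.
Proof.
move=> t0 tn; rewrite -!natrM ler_nat.
have m0 : (0 < n %/ t)%N by rewrite divn_gt0.
have := ltn_ceil n t0; rewrite mulSn => /ltnW /leq_trans; apply.
by rewrite -mulnA mul2n -addnn mulnC leq_add2r leq_pmulr.
Qed.

Theorem theorem2p10 (R : realType) (q t : nat) (hq : (2 <= q)%N)
    (ht : (1 <= t)%N) :
  exists A : R, forall (k : nat -> nat) (h : nat -> R),
    (\forall n \near \oo, A * lg (lg (n%:R : R)) <= h n) ->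
    (\forall n \near \oo,
       (k n)%:R <= (t%:R * lg (n%:R : R) - h n)
                   / lg ((q%:R ^+ t : R) / (q%:R ^+ t - 1))) ->
    (fun n : nat => array_prob R (@covering_array t q n (k n))) @ \oo
      --> (0 : R).
Proof.
(* With A = t, the bound on k turns a ^ k into at most n / lg n. *)
exists t%:R => k h hA hk.
set N : R := q%:R ^+ t in hk.
have N2 : 2 <= N by exact: alphabet_power_ge2.
have t0 : 0 < (t%:R : R) by rewrite ltr0n.
have ln2 : 0 < ln (2 : R) by rewrite ln_gt0// ltr1n.
pose L := ln (N / (N - 1)).
have L0 : 0 < L by rewrite ln_gt0// ltr_pdivlMr; lra.
pose a := expR (L / t%:R).
have aN : a ^+ t = N / (N - 1).
  rewrite -expRM_natr divfK ?gt_eqF// lnK// posrE divr_gt0; lra.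
(* The factor [2 * t] is the cost of replacing the block size [n %/ t] by [n], and [ln 2] converts
   [lg n] to [ln n]. *)
pose C : R := 2 * t%:R * ln 2.
apply: (@squeeze_cvgr _ _ _ _ (fun=> 0)
  (fun n => (1 + C * (ln n%:R)^-1) ^+ t - 1)).
- near=> n.
  have n2 : (2 < n)%N by near: n; exact: nbhs_infty_gt.
  have tn : (t <= n)%N by near: n; exact: nbhs_infty_ge.
  have n0 : 0 < (n%:R : R) by rewrite ltr0n (leq_trans _ n2).
  have lnn : 0 < ln (n%:R : R) by rewrite ln_gt0// ltr1n (leq_trans _ n2).
  have lg0 : 0 < lg (n%:R : R) by rewrite divr_gt0.
  have m0 : (0 < n %/ t)%N by rewrite divn_gt0.
  have mR0 : 0 < ((n %/ t)%:R : R) by rewrite ltr0n.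
  apply/andP; split; first by apply: sumr_ge0 => M _; exact: array_mass_ge0.
  have tmn : (#|{: 'I_t * 'I_(n %/ t)}| <= n)%N.
    by rewrite card_prod !card_ord mulnC leq_divM.
  (* Enumerating the pairs fills the first [t * (n %/ t)] columns; the remainder lies in no
     block. *)
  pose col (x : 'I_t * 'I_(n %/ t)) : 'I_n := widen_ord tmn (enum_rank x).
  have col_inj : injective col.
    by move=> x y /(congr1 val) /= /val_inj /enum_rank_inj.
  apply: le_trans (covering_prob_le _ hq ht m0 col_inj (expR_ge0 _) aN) _.
  rewrite lerD2r; apply: lerXn2r; rewrite ?nnegrE ?lerD2l.
  + by rewrite addr_ge0// divr_ge0 ?exprn_ge0 ?expR_ge0.
  + by rewrite addr_ge0// divr_ge0 ?ltW// !mulr_gt0.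
  have le_rho : a ^+ k n <= n%:R / lg (n%:R : R).
    have -> : n%:R / lg (n%:R : R) = expR (ln n%:R - ln (lg (n%:R : R))).
      by rewrite expRD expRN !lnK ?posrE.
    rewrite -expRM_natl ler_expR mulrA ler_pdivrMr//.
    have hAn : t%:R * lg (lg (n%:R : R)) <= h n by near: n.
    have : (k n)%:R <= (t%:R * lg (n%:R : R) - h n) / lg (N / (N - 1)).
      by near: n.
    (* Clearing the denominator [L / ln 2] gives [k L <= (t lg n - h) ln 2]; with [h >= t lg lg n]
       the right side is at most [t (ln n - ln (lg n))]. *)
    rewrite /lg -/L ler_pdivlMr ?divr_gt0// [leLHS]mulrA ler_pdivrMr// => hkn.
    apply: le_trans hkn _.
    have := ler_wpM2r (ltW ln2) hAn; rewrite {1}/lg mulrA divfK ?gt_eqF//.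
    rewrite mulrBl -mulrA divfK ?gt_eqF// -/(lg _) => le_h.
    by rewrite mulrBl; lra.
  rewrite ler_pdivrMr// (le_trans le_rho)// /lg invf_div [leLHS]mulrA.
  rewrite [leRHS]mulrAC ler_pM2r ?invr_gt0// /C [leRHS]mulrAC ler_pM2r//.
  exact: block_size_ge.
- exact: cvg_cst.
- have -> : (0 : R) = (1 + C * 0) ^+ t - 1 by rewrite mulr0 addr0 expr1n subrr.
  apply: cvgB; last exact: cvg_cst.
  apply: (continuous_cvg _ (@exprn_continuous R t _)).
  apply: cvgD; first exact: cvg_cst.
  by apply: cvgM; [exact: cvg_cst|exact: cvg_ln_natV].
Unshelve. all: by end_near. Qed.
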